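(* Let $r\ge 0$ be an integer. Then, as formal power series in $x$, $$\sum_{n=0}^\infty h_n^{(r)}x^n=\frac{1}{1-\log(1+x)/(1+x)^r}=\cfrac{1}{1-\cfrac{x}{(1+x)^r+\cfrac{x(1+x)^r}{2-x+\cfrac{2^2 x}{3-2x+\cfrac{3^2 x}{4-3x+\ddots}}}}}$$ and $$\sum_{n=1}^\infty H_n^{(r)}x^n=-\frac{\log(1-x)}{(1-x)^r}=\cfrac{x}{(1-x)^r-\cfrac{x(1-x)^r}{2+x-\cfrac{2^2x}{3+2x-\cfrac{3^2x}{4+3x-\cfrac{4^2x}{5+4x-\ddots}}}}}.$$
   Context: The hyperharmonic numbers $H_n^{(r)}$ ($n\ge1$) are defined by $H_n^{(0)}=\frac1n$ and $H_n^{(r)}=\sum_{k=1}^nH_k^{(r-1)}$ for $r\ge1$; equivalently $\sum_{n\ge1}H_n^{(r)}x^n=-\frac{\log(1-x)}{(1-x)^r}$. The determinantal hyperharmonic numbers $h_n^{(r)}$ of order $r$ are defined by $\sum_{n=0}^\infty h_n^{(r)}x^n=\frac{1}{1-\log(1+x)/(1+x)^r}$. After the displayed initial levels, the continued fractions proceed with levels $\cfrac{m^2x}{(m+1)-mx+\cdots}$ (added, first fraction) and $\cfrac{m^2x}{(m+1)+mx-\cdots}$ (subtracted, second fraction), for $m=2,3,4,\dots$. An infinite continued fraction is the limit, in the $x$-adic topology on formal power series, of its finite truncations, each truncation being a rational function of $x$ expanded as a formal power series at $x=0$. *)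

(* Defs.v *)
From HB Require Import structures.
From mathcomp Require Import all_boot all_order all_algebra.
From mathcomp Require Import boolp.

Set Implicit Arguments.
Unset Strict Implicit.
Unset Printing Implicit Defensive.

Import GRing.Theory.
Local Open Scope ring_scope.
Local Notation "x %:F" := (FracField.tofrac x) : ring_scope.

(* A formal power series in one variable x over K, as the sequence of its
   coefficients. The record wrapper keeps this type apart from [nat -> K], whose
   pointwise product is not the Cauchy product. *)
Record fps (K : fieldType) := Fps { fcoef : nat -> K }.

Lemma fpsP (K : fieldType) (f g : fps K) :
  (forall n, fcoef f n = fcoef g n) -> f = g.
Proof. by case: f => f; case: g => g /= /funext ->. Qed.

HB.instance Definition _ (K : fieldType) := gen_eqMixin (fps K).
HB.instance Definition _ (K : fieldType) := gen_choiceMixin (fps K).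

Section FpsRing.
Variable K : fieldType.
Implicit Types f g h : fps K.

Definition fps_of_poly (p : {poly K}) : fps K := Fps (fun n => p`_n).

Definition fps_add f g : fps K := Fps (fun n => fcoef f n + fcoef g n).
Definition fps_opp f : fps K := Fps (fun n => - fcoef f n).
Definition fps_mul f g : fps K :=
  Fps (fun n => \sum_(j < n.+1) fcoef f j * fcoef g (n - j)).

Fact fps_addA : associative fps_add.
Proof. by move=> f g h; apply: fpsP => n /=; rewrite addrA. Qed.
Fact fps_addC : commutative fps_add.
Proof. by move=> f g; apply: fpsP => n /=; rewrite addrC. Qed.
Fact fps_add0 : left_id (fps_of_poly 0) fps_add.
Proof. by move=> f; apply: fpsP => n /=; rewrite coef0 add0r. Qed.
Fact fps_addN : left_inverse (fps_of_poly 0) fps_opp fps_add.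
Proof. by move=> f; apply: fpsP => n /=; rewrite coef0 addNr. Qed.

HB.instance Definition _ :=
  GRing.isZmodule.Build (fps K) fps_addA fps_addC fps_add0 fps_addN.

Definition fps_trunc N f : {poly K} := \poly_(i < N) fcoef f i.

Lemma fcoef_mul_trunc N f g n : (n < N)%N ->
  fcoef (fps_mul f g) n = (fps_trunc N f * fps_trunc N g)`_n.
Proof.
move=> ltnN; rewrite coefM /=; apply: eq_bigr => j _; rewrite !coef_poly.
by rewrite (leq_ltn_trans (leq_subr _ _) ltnN) (leq_trans (ltn_ord j) ltnN).
Qed.

Fact fps_mulC : commutative fps_mul.
Proof.
move=> f g; apply: fpsP => n.
by rewrite !(@fcoef_mul_trunc n.+1) // mulrC.
Qed.

Fact fps_mulA : associative fps_mul.
Proof.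
move=> f g h; apply: fpsP => n; pose t := fps_trunc n.+1.
transitivity ((t f * (t g * t h))`_n).
  rewrite coefM; apply: eq_bigr => j _.
  rewrite [(t f)`_j]coef_poly ltn_ord; congr (_ * _).
  by apply: fcoef_mul_trunc; rewrite ltnS leq_subr.
rewrite mulrA coefM; apply: eq_bigr => j _.
rewrite [(t h)`__]coef_poly ltnS leq_subr; congr (_ * _).
by apply/esym/fcoef_mul_trunc.
Qed.

Fact fps_mul1 : left_id (fps_of_poly 1) fps_mul.
Proof.
move=> f; apply: fpsP => n /=.
rewrite big_ord_recl coef1 eqxx mul1r subn0 big1 ?addr0 // => j _.
by rewrite coef1 /= mul0r.
Qed.

Fact fps_mulDl : left_distributive fps_mul +%R.
Proof.
move=> f g h; apply: fpsP => n /=.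
by rewrite -big_split; apply: eq_bigr => j _; rewrite mulrDl.
Qed.

Fact fps_oner_neq0 : fps_of_poly 1 != 0.
Proof.
apply/eqP => /(congr1 (fun f => fcoef f 0)) /=.
by rewrite coef1 coef0 => /eqP; rewrite oner_eq0.
Qed.

HB.instance Definition _ := GRing.Zmodule_isComNzRing.Build (fps K)
  fps_mulA fps_mulC fps_mul1 fps_mulDl fps_oner_neq0.

(* The first n+1 coefficients of 1/f, by the usual recursion. *)
Fixpoint fps_inv_seq f n : seq K :=
  if n is m.+1 then
    let s := fps_inv_seq f m in
    rcons s (- (fcoef f 0)^-1 * \sum_(j < m.+1) fcoef f j.+1 * s`_(m - j))
  else [:: (fcoef f 0)^-1].

Definition fps_unit : {pred fps K} := fun f => fcoef f 0 != 0.

(* As usual in MathComp, the inverse of a non-unit is itself. *)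
Definition fps_inv f : fps K :=
  if f \in fps_unit then Fps (fun n => (fps_inv_seq f n)`_n) else f.

Lemma size_fps_inv_seq f n : size (fps_inv_seq f n) = n.+1.
Proof. by elim: n => //= n IHn; rewrite size_rcons IHn. Qed.

Lemma nth_fps_inv_seq f n i : (i <= n)%N ->
  (fps_inv_seq f n)`_i = (fps_inv_seq f i)`_i.
Proof.
elim: n => [|n IHn]; first by rewrite leqn0 => /eqP ->.
rewrite leq_eqVlt => /predU1P[-> // | ltin] /=.
by rewrite nth_rcons size_fps_inv_seq ltin IHn.
Qed.

Fact fps_mulVf : {in fps_unit, left_inverse 1 fps_inv *%R}.
Proof.
move=> f uf; rewrite mulrC; apply: fpsP => n /=.
rewrite /fps_inv uf; have f0 : fcoef f 0 != 0 := uf.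
rewrite big_ord_recl subn0 coef1 /=; case: n => [|n] /=.
  by rewrite big_ord0 addr0 mulfV.
rewrite nth_rcons size_fps_inv_seq ltnn eqxx mulNr mulrN mulVKf //.
rewrite addrC; apply/eqP; rewrite subr_eq0; apply/eqP.
apply: eq_bigr => j _; rewrite /bump /= add1n subSS.
by rewrite (@nth_fps_inv_seq f n) ?leq_subr.
Qed.

Fact fps_unitPl f g : g * f = 1 -> fps_unit f.
Proof.
move=> /(congr1 (fun h => fcoef h 0)) /=; rewrite big_ord1 coef1 /= => gf1.
rewrite /fps_unit; apply/eqP => f0; move/eqP: gf1.
by rewrite f0 mulr0 eq_sym oner_eq0.
Qed.

Fact fps_inv_out : {in [predC fps_unit], fps_inv =1 id}.
Proof. by move=> f /negbTE nuf; rewrite /fps_inv nuf. Qed.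

HB.instance Definition _ := GRing.ComNzRing_hasMulInverse.Build (fps K)
  fps_mulVf fps_unitPl fps_inv_out.

Definition fpsX : fps K := fps_of_poly 'X.

(* log f = \sum_(k >= 1) (-1)^(k-1) (f - 1)^k / k, for f with constant term 1;
   the terms with k > n do not contribute to the coefficient of x^n. *)
Definition fps_log f : fps K :=
  Fps (fun n =>
    \sum_(1 <= k < n.+1) (-1) ^+ k.-1 / k%:R * fcoef ((f - 1) ^+ k) n).

Definition xadic_cvg (t : nat -> fps K) f : Prop :=
  forall N : nat, exists M : nat, forall n : nat, (M <= n)%N ->
    forall i : nat, (i < N)%N -> fcoef (t n) i = fcoef f i.

(* f is the power series expansion at x = 0 of the rational function g, which
   in particular has no pole there. *)
Definition expansion_at0 (g : {fraction {poly K}}) f : Prop :=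
  exists p q : {poly K},
    [/\ q.[0] != 0, g = p%:F / q%:F & f = fps_of_poly p / fps_of_poly q].

(* cf_trunc a b n i is the finite continued fraction with n levels
     a_i / (b_i + a_(i+1) / (b_(i+1) + ... + a_(i+n-1) / b_(i+n-1))). *)
Fixpoint cf_trunc (a b : nat -> {poly K}) (n i : nat) : {fraction {poly K}} :=
  if n is m.+1 then (a i)%:F / ((b i)%:F + cf_trunc a b m i.+1) else 0.

(* f is the value of the infinite continued fraction
     a_0 / (b_0 + a_1 / (b_1 + a_2 / (b_2 + ...))).
   The first clause says that no truncation involves a division by 0. *)
Definition cf_value (a b : nat -> {poly K}) f : Prop :=
  (forall n i : nat, (b i)%:F + cf_trunc a b n i.+1 != 0) /\
  exists t : nat -> fps K,
    (forall n : nat, expansion_at0 (cf_trunc a b n 0) (t n)) /\ xadic_cvg t f.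

End FpsRing.

Arguments fpsX {K}.

(* H_n^(r) for n >= 1. *)
Fixpoint hyperharmonic (r n : nat) : rat :=
  if r is s.+1 then \sum_(1 <= k < n.+1) hyperharmonic s k else n%:R^-1.

Definition hyperharmonic_fps (r : nat) : fps rat :=
  Fps (fun n => if (0 < n)%N then hyperharmonic r n else 0).

Definition det_hyperharmonic (r n : nat) : rat :=
  fcoef (1 / (1 - fps_log (1 + fpsX) / (1 + fpsX) ^+ r)) n.

(* Partial numerators and denominators; a fraction that is subtracted is
   encoded by a negated partial numerator. *)
Definition det_num (r i : nat) : {poly rat} :=
  match i with
  | 0 => 1
  | 1 => - 'X
  | 2 => 'X * (1 + 'X) ^+ r
  | m.+1 => m%:R ^+ 2 * 'X
  end.

Definition det_den (r i : nat) : {poly rat} :=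
  match i with
  | 0 => 1
  | 1 => (1 + 'X) ^+ r
  | m.+1 => m.+1%:R - m%:R * 'X
  end.

Definition hyp_num (r i : nat) : {poly rat} :=
  match i with
  | 0 => 'X
  | 1 => - ('X * (1 - 'X) ^+ r)
  | m => - (m%:R ^+ 2 * 'X)
  end.

Definition hyp_den (r i : nat) : {poly rat} :=
  match i with
  | 0 => (1 - 'X) ^+ r
  | m => m.+1%:R + m%:R * 'X
  end.

(* Main.v *)
Require Import Defs.
From HB Require Import structures.
From mathcomp Require Import all_boot all_order all_algebra.
From mathcomp Require Import boolp ring.

Set Implicit Arguments.
Unset Strict Implicit.
Unset Printing Implicit Defensive.

Import GRing.Theory.
Local Open Scope ring_scope.
Local Notation "x %:F" := (FracField.tofrac x) : ring_scope.

(** Both continued fractions are instances of Euler's transformation of a series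
    into a continued fraction, applied to the logarithmic series. For a
    polynomial y without constant term and a polynomial u with nonzero constant
    term, consider
      - y / (u + y u / (2 - y + 2^2 y / (3 - 2 y + 3^2 y / (4 - 3 y + ...)))).
    The claim is that its truncation with n levels is exactly - L_n / u, where
    L_n is the sum of the terms of degree at most n in y of
      log (1 + y) = y - y^2 / 2 + y^3 / 3 - ...
    Convergence is then immediate: L_n and log (1 + y) have the same
    coefficients up to x^n.

    The claim comes from a closed form for the inner tails. Let
      R_n(m) = 1 / m - y / (m + 1) + ... + (- y)^n / (m + n).
    The n-level truncation that starts with the partial numerator m^2 y is
    1 / R_n(m) - m. This follows by induction on n [euler_tail]: one more level
    is absorbed by the identity [euler_step], which turns R into 1 / m - y R,
    and R_(n+1)(m) = 1 / m - y R_n(m + 1) [log_tailS]. With m = 1 and the factor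
    u, the outermost denominator collapses to u / R_n(1), and y R_n(1) is
    L_(n+1). The same closed form shows that no denominator vanishes: each
    is a quotient of polynomials with nonzero values at 0.

    With y = - X and u = (1 - X)^r the fraction is the one for the
    hyperharmonic numbers [euler_cf_value]. With y = X and u = (1 + X)^r it is
    the part below the level 1 / (1 + ...) of the one for the determinantal
    numbers, and this level sends - L_n / u to u / (u - L_n)
    [inv_euler_cf_value]; the inverse of power series preserves agreement of
    initial coefficients, so this converges too. The generating function of the
    hyperharmonic numbers is found by induction on r: multiplying by 1 - X
    undoes a partial summation [hyperharmonic_fpsE]. *)

(** * Power series and their initial coefficients *)

Lemma fps_of_poly_is_zmod_morphism (K : fieldType) :
  zmod_morphism (@fps_of_poly K).
Proof. by move=> p q; apply: fpsP => n /=; rewrite coefB. Qed.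

HB.instance Definition _ (K : fieldType) :=
  GRing.isZmodMorphism.Build {poly K} (fps K) (@fps_of_poly K)
    (@fps_of_poly_is_zmod_morphism K).

Lemma fps_of_poly_is_monoid_morphism (K : fieldType) :
  monoid_morphism (@fps_of_poly K).
Proof. by split=> // p q; apply: fpsP => n /=; rewrite coefM. Qed.

HB.instance Definition _ (K : fieldType) :=
  GRing.isMonoidMorphism.Build {poly K} (fps K) (@fps_of_poly K)
    (@fps_of_poly_is_monoid_morphism K).

Lemma unit_fpsE (K : fieldType) (f : fps K) :
  (f \is a GRing.unit) = (fcoef f 0 != 0).
Proof. by []. Qed.

Lemma unit_fps_of_poly (K : fieldType) (p : {poly K}) :
  (fps_of_poly p \is a GRing.unit) = (p.[0] != 0).
Proof. by rewrite unit_fpsE horner_coef0. Qed.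

Lemma fcoefD (K : fieldType) (f g : fps K) n :
  fcoef (f + g) n = fcoef f n + fcoef g n.
Proof. by []. Qed.

Lemma fcoefN (K : fieldType) (f : fps K) n : fcoef (- f) n = - fcoef f n.
Proof. by []. Qed.

Lemma fcoefMX (K : fieldType) (f : fps K) n :
  fcoef (f * fpsX) n = if n is m.+1 then fcoef f m else 0.
Proof.
rewrite mulrC /= big_ord_recl coefX mul0r add0r.
case: n => [|n]; first by rewrite big_ord0.
rewrite big_ord_recl coefX mul1r subSS subn0 big1 ?addr0 // => j _.
by rewrite coefX mul0r.
Qed.

(** Congruence modulo x^N: the convergence of power series asks for it at
    every N. *)
Definition fps_agree (K : fieldType) N (f g : fps K) :=
  forall i, (i < N)%N -> fcoef f i = fcoef g i.

Lemma fps_agreeB (K : fieldType) N (f g f' g' : fps K) :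
  fps_agree N f f' -> fps_agree N g g' -> fps_agree N (f - g) (f' - g').
Proof. by move=> ff gg i ltiN; rewrite !fcoefD !fcoefN ff ?gg. Qed.

Lemma fps_agreeM (K : fieldType) N (f g f' g' : fps K) :
  fps_agree N f f' -> fps_agree N g g' -> fps_agree N (f * g) (f' * g').
Proof.
move=> ff gg i ltiN /=; apply: eq_bigr => j _.
rewrite ff ?gg ?(leq_ltn_trans (leq_subr _ _) ltiN) //.
exact: leq_ltn_trans (leq_ord j) ltiN.
Qed.

(** Multiplying f = g by 1 / (f g) exchanges the inverses, so compatibility
    with products suffices. *)
Lemma fps_agreeV (K : fieldType) N (f g : fps K) :
  f \is a GRing.unit -> g \is a GRing.unit ->
  fps_agree N f g -> fps_agree N f^-1 g^-1.
Proof.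
move=> uf ug fg; suff: fps_agree N (f^-1 * (g * g^-1)) (f^-1 * (f * g^-1)).
  by rewrite divrr // mulr1 mulKr.
by do 2![apply: fps_agreeM => //]; move=> i ltiN; rewrite fg.
Qed.

(** * The logarithmic series and its tails *)

Definition log_poly (K : fieldType) (y : {poly K}) N : {poly K} :=
  \sum_(1 <= k < N.+1) ((-1) ^+ k.-1 / k%:R) *: y ^+ k.

Lemma coef_exp_lt (K : fieldType) (y : {poly K}) k n :
  y.[0] = 0 -> (n < k)%N -> (y ^+ k)`_n = 0.
Proof.
move=> /eqP/factor_theorem[q ->] ltnk.
by rewrite subr0 exprMn coefMXn ltnk.
Qed.

Lemma log_poly0 (K : fieldType) (y : {poly K}) N :
  y.[0] = 0 -> (log_poly y N).[0] = 0.
Proof.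
move=> y0; rewrite horner_coef0 coef_sum big_nat big1 // => k /andP[k_gt0 _].
by rewrite coefZ coef_exp_lt ?mulr0.
Qed.

(** The powers y^k with k > N start beyond x^N, so they are invisible in the
    first N + 1 coefficients. *)
Lemma log_poly_agree (K : fieldType) (y : {poly K}) N :
  y.[0] = 0 ->
  fps_agree N.+1 (fps_of_poly (log_poly y N)) (fps_log (1 + fps_of_poly y)).
Proof.
move=> y0 n ltnN; rewrite /= coef_sum (big_cat_nat (n := n.+1)) //=.
rewrite [X in _ + X]big_nat [X in _ + X]big1 ?addr0 => [|k /andP[ltnk _]].
  by apply: eq_bigr => k _; rewrite addrC addKr -rmorphXn coefZ.
by rewrite coefZ coef_exp_lt ?mulr0.
Qed.

Lemma fcoef0_log (K : fieldType) (f : fps K) : fcoef (fps_log f) 0 = 0.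
Proof. by rewrite /= big_geq. Qed.

(** The partial sum R_n(m) of 1 / m - y / (m + 1) + y^2 / (m + 2) - ..., whose
    inverse is m plus a truncated tail of Euler's continued fraction. *)
Definition log_tail (K : fieldType) (y : {poly K}) n m : {poly K} :=
  \sum_(k < n.+1) ((-1) ^+ k / (m + k)%:R) *: y ^+ k.

Lemma log_tail0 (K : fieldType) (y : {poly K}) m :
  log_tail y 0 m = m%:R^-1%:P.
Proof. by rewrite /log_tail big_ord1 addn0 mul1r expr0 alg_polyC. Qed.

Lemma log_tailS (K : fieldType) (y : {poly K}) n m :
  log_tail y n.+1 m = m%:R^-1%:P - y * log_tail y n m.+1.
Proof.
rewrite /log_tail big_ord_recl addn0 mul1r expr0 alg_polyC; congr (_ + _).
rewrite mulr_sumr -sumrN; apply: eq_bigr => k _.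
by rewrite lift0 addnS -scalerAr -exprS -scaleNr exprS mulN1r mulNr.
Qed.

Lemma log_tail_horner0 (K : fieldType) (y : {poly K}) n m :
  y.[0] = 0 -> (log_tail y n m).[0] = m%:R^-1.
Proof.
move=> y0; case: n => [|n]; rewrite ?log_tail0 ?log_tailS !hornerE //.
by rewrite y0 mul0r subr0.
Qed.

Lemma log_polyS (K : fieldType) (y : {poly K}) n :
  log_poly y n.+1 = y * log_tail y n 1.
Proof.
rewrite /log_poly big_add1 big_mkord mulr_sumr; apply: eq_bigr => k _.
by rewrite -scalerAr -exprS.
Qed.

(** * Euler's continued fraction for the logarithm *)

Lemma horner0_neq0 (K : fieldType) (p : {poly K}) : p.[0] != 0 -> p != 0.
Proof. by apply: contraNneq => ->; rewrite horner0. Qed.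

Lemma cf_trunc_shift (K : fieldType) (a b : nat -> {poly K}) n i :
  cf_trunc a b n i.+1 = cf_trunc (a \o S) (b \o S) n i.
Proof. by elim: n i => //= n IHn i; rewrite IHn. Qed.

Lemma euler_step_den (F : fieldType) (m y R : F) :
  R != 0 -> m + 1 - m * y + (R^-1 - (m + 1)) = (1 - m * y * R) / R.
Proof. by move=> R0; field. Qed.

(** One level of the continued fraction: if the tail from m + 1 on is
    1 / R - (m + 1), then the tail from m on is 1 / (1 / m - y R) - m. *)
Lemma euler_step (F : fieldType) (m y R : F) :
  m != 0 -> R != 0 -> 1 - m * y * R != 0 ->
  m ^+ 2 * y / (m + 1 - m * y + (R^-1 - (m + 1))) = (m^-1 - y * R)^-1 - m.
Proof.
move=> m0 R0 D0; rewrite euler_step_den //.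
have ->: m^-1 - y * R = (1 - m * y * R) / m by field.
by field; apply/and3P.
Qed.

(** The first two levels carry the factor u, which makes the value
    - log (1 + y) / u. With - y as outermost numerator, y = X gives the
    subtracted level of the determinantal fraction, and y = - X the outermost
    level of the hyperharmonic one. *)
Definition euler_num (K : fieldType) (y u : {poly K}) i : {poly K} :=
  match i with
  | 0 => - y
  | 1 => y * u
  | m => m%:R ^+ 2 * y
  end.

Definition euler_den (K : fieldType) (y u : {poly K}) i : {poly K} :=
  if i is m.+1 then i.+1%:R - i%:R * y else u.

Lemma natrS_neq0 (K : fieldType) m :
  [pchar K] =i pred0 -> (m.+1%:R : K) != 0.
Proof. by move/pcharf0P=> ->. Qed.

Lemma natrS_frac_neq0 (K : fieldType) m :
  [pchar K] =i pred0 -> (m.+1%:R : {fraction {poly K}}) != 0.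
Proof.
move=> charK; rewrite -(rmorph_nat (@FracField.tofrac _)) -polyC_natr.
by rewrite tofrac_eq0 polyC_eq0 natrS_neq0.
Qed.

Lemma tofrac_natrSV (K : fieldType) m :
  [pchar K] =i pred0 -> (m.+1%:R^-1 : K)%:P%:F = m.+1%:R^-1.
Proof.
move=> charK; apply: (mulIf (natrS_frac_neq0 m charK)).
rewrite mulVf ?natrS_frac_neq0 // -(rmorph_nat (@FracField.tofrac _)).
by rewrite -tofracM -polyC_natr -polyCM mulVf ?natrS_neq0 // tofrac1.
Qed.

Lemma log_tail_neq0 (K : fieldType) (y : {poly K}) n m :
  [pchar K] =i pred0 -> y.[0] = 0 -> (log_tail y n m.+1)%:F != 0.
Proof.
move=> charK y0; rewrite tofrac_eq0 horner0_neq0 // log_tail_horner0 //.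
by rewrite invr_eq0 natrS_neq0.
Qed.

(** The value at 0 is 1. With p = R_n(m + 1), division by p gives the
    denominators of the continued fraction. *)
Lemma sub1_frac_neq0 (K : fieldType) (y p : {poly K}) m :
  y.[0] = 0 -> 1 - m%:R * y%:F * p%:F != 0.
Proof.
move=> y0; rewrite -(rmorph_nat (@FracField.tofrac _)) -!tofracM -tofrac1.
rewrite -tofracB tofrac_eq0 horner0_neq0 // !hornerE y0 mulr0 mul0r subr0.
exact: oner_neq0.
Qed.

Lemma euler_den_neq0 (K : fieldType) (y : {poly K}) n m :
  [pchar K] =i pred0 -> y.[0] = 0 ->
  (m.+1%:R - m%:R * y)%:F + ((log_tail y n m.+1)%:F^-1 - m.+1%:R) != 0.
Proof.
move=> charK y0; have R0 := log_tail_neq0 n m charK y0.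
have D0 := sub1_frac_neq0 (log_tail y n m.+1) m y0.
rewrite tofracB tofracM !rmorph_nat.
have := euler_step_den m%:R y%:F R0; rewrite natr1 => ->.
exact: mulf_neq0 D0 (invr_neq0 R0).
Qed.

Lemma log_tail_step (K : fieldType) (y : {poly K}) n m :
  [pchar K] =i pred0 -> y.[0] = 0 ->
  m.+1%:R ^+ 2 * y%:F /
    ((m.+2%:R - m.+1%:R * y)%:F + ((log_tail y n m.+2)%:F^-1 - m.+2%:R)) =
  (log_tail y n.+1 m.+1)%:F^-1 - m.+1%:R.
Proof.
move=> charK y0; rewrite log_tailS !(tofracB, tofracM) tofrac_natrSV //.
rewrite !rmorph_nat.
have := euler_step (natrS_frac_neq0 m charK) (log_tail_neq0 n m.+1 charK y0)
  (sub1_frac_neq0 (log_tail y n m.+2) m.+1 y0).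
by rewrite natr1.
Qed.

Lemma euler_tail (K : fieldType) (y u : {poly K}) n m :
  [pchar K] =i pred0 -> y.[0] = 0 ->
  cf_trunc (euler_num y u) (euler_den y u) n m.+2 =
  (log_tail y n m.+2)%:F^-1 - m.+2%:R.
Proof.
move=> charK y0; elim: n m => [|n IHn] m /=.
  by rewrite log_tail0 tofrac_natrSV // invrK subrr.
rewrite IHn -log_tail_step // tofracM rmorphXn /=.
by rewrite (rmorph_nat (@FracField.tofrac _)).
Qed.

(** The second level is the case m = 1 of the tails, multiplied by u. *)
Lemma euler_tail1 (K : fieldType) (y u : {poly K}) n :
  [pchar K] =i pred0 -> y.[0] = 0 ->
  cf_trunc (euler_num y u) (euler_den y u) n 1 =
  u%:F * ((log_tail y n 1)%:F^-1 - 1).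
Proof.
move=> charK y0; case: n => [|n] /=.
  by rewrite log_tail0 tofrac_natrSV // invrK subrr mulr0.
rewrite euler_tail // -[1]/(1%:R) -log_tail_step // expr1n mul1r.
by rewrite tofracM [y%:F * _]mulrC -mulrA.
Qed.

Lemma euler_cf_den_neq0 (K : fieldType) (y u : {poly K}) n i :
  [pchar K] =i pred0 -> y.[0] = 0 -> u != 0 ->
  (euler_den y u i)%:F
    + cf_trunc (euler_num y u) (euler_den y u) n i.+1 != 0.
Proof.
move=> charK y0 u0; case: i => [|i]; last first.
  by rewrite euler_tail //; apply: euler_den_neq0.
rewrite euler_tail1 //= mulrBr mulr1 addrC subrK mulf_neq0 ?tofrac_eq0 //.
by rewrite invr_eq0; apply: log_tail_neq0.
Qed.

(** The transformation is exact at every stage: truncated fractions are partial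
    sums of the series. *)
Lemma euler_cf_trunc (K : fieldType) (y u : {poly K}) n :
  [pchar K] =i pred0 -> y.[0] = 0 ->
  cf_trunc (euler_num y u) (euler_den y u) n 0 = - ((log_poly y n)%:F / u%:F).
Proof.
move=> charK y0; case: n => [|n].
  by rewrite /log_poly big_geq //= tofrac0 mul0r oppr0.
rewrite log_polyS /= euler_tail1 // mulrBr mulr1 addrC subrK.
by rewrite invfM invrK tofracN tofracM mulNr mulrA mulrAC.
Qed.

(** * Values of the infinite continued fractions *)

Lemma euler_cf_value (K : fieldType) (y u : {poly K}) :
  [pchar K] =i pred0 -> y.[0] = 0 -> u.[0] != 0 ->
  cf_value (euler_num y u) (euler_den y u)
    (- (fps_log (1 + fps_of_poly y) / fps_of_poly u)).
Proof.
move=> charK y0 u0; split=> [n i|].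
  by apply: euler_cf_den_neq0 => //; apply: horner0_neq0.
exists (fun n => - (fps_of_poly (log_poly y n) / fps_of_poly u)); split=> [n|N].
  exists (- log_poly y n), u; split=> //.
    by rewrite euler_cf_trunc // tofracN mulNr.
  by rewrite rmorphN mulNr.
exists N => n leNn i ltiN; rewrite !fcoefN; congr (- _).
apply: fps_agreeM (ltiN) => // j ltjN.
by apply: log_poly_agree => //; apply: leq_trans ltjN (leqW leNn).
Qed.

(** A level 1 / (1 + ...) on top of Euler's fraction. The expansion of a
    truncation must be a quotient of polynomials whose denominator is nonzero
    at 0: it is u / (u - L_n), because L_n vanishes at 0 and u does not. *)
Lemma inv_euler_cf_value (K : fieldType) (y u : {poly K})
    (a b : nat -> {poly K}) :
  [pchar K] =i pred0 -> y.[0] = 0 -> u.[0] != 0 ->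
  a 0 = 1 -> b 0 = 1 ->
  a \o S = euler_num y u -> b \o S = euler_den y u ->
  cf_value a b (1 / (1 - fps_log (1 + fps_of_poly y) / fps_of_poly u)).
Proof.
move=> charK y0 u0 a0 b0 aS bS.
have uB0 n : (u - log_poly y n).[0] != 0.
  by rewrite !hornerE log_poly0 // subr0.
have uF0 : u%:F != 0 by rewrite tofrac_eq0 horner0_neq0.
have D0 n : (u - log_poly y n)%:F != 0.
  by rewrite tofrac_eq0 horner0_neq0.
have den0 n : 1 + cf_trunc a b n 1 = (u - log_poly y n)%:F / u%:F.
  rewrite cf_trunc_shift aS bS euler_cf_trunc // tofracB mulrBl.
  by rewrite divff.
split=> [n [|i]|].
- by rewrite b0 tofrac1 den0; exact: mulf_neq0 (D0 n) (invr_neq0 uF0).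
- by rewrite cf_trunc_shift aS bS -[b i.+1]/((b \o S) i) bS;
    apply: euler_cf_den_neq0 => //; apply: horner0_neq0.
(* A truncation with no level is 0, so Euler's fraction lags one level
   behind. *)
pose t n := if n is m.+1 then
  fps_of_poly u / fps_of_poly (u - log_poly y m) else 0.
exists t; split=> [[|n]|N].
- by exists 0, 1; rewrite hornerE oner_neq0 tofrac0 rmorph0 !mul0r.
- exists u, (u - log_poly y n); split=> //=.
  by rewrite a0 b0 tofrac1 den0 mul1r invfM invrK mulrC.
have uu : fps_of_poly u \is a GRing.unit by rewrite unit_fps_of_poly.
have uL : fps_of_poly u - fps_log (1 + fps_of_poly y) \is a GRing.unit.
  by rewrite unit_fpsE fcoefD fcoefN fcoef0_log subr0.
have -> : 1 / (1 - fps_log (1 + fps_of_poly y) / fps_of_poly u) =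
    fps_of_poly u / (fps_of_poly u - fps_log (1 + fps_of_poly y)).
  rewrite -[X in X - _](divrr uu) -mulrBl invrM ?unitrV // invrK.
  by rewrite mul1r.
exists N.+1 => -[|n] // leNn; apply: fps_agreeM => //.
apply: fps_agreeV => //; first by rewrite unit_fps_of_poly.
rewrite rmorphB /=; apply: fps_agreeB => // i ltiN.
by apply: log_poly_agree => //; apply: leq_trans ltiN (leqW leNn).
Qed.

(** * Hyperharmonic numbers and the theorem *)

Lemma log_1subX (K : fieldType) n :
  fcoef (fps_log (1 - @fpsX K)) n = - (if (0 < n)%N then n%:R^-1 else 0).
Proof.
case: n => [|n]; first by rewrite fcoef0_log oppr0.
have coefE k : fcoef ((1 - fpsX - 1 : fps K) ^+ k) n.+1 =
    (-1) ^+ k * (n.+1 == k)%:R.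
  rewrite addrC addKr -[- fpsX](rmorphN (@fps_of_poly K)) -rmorphXn /=.
  by rewrite [(- 'X) ^+ k]exprNn -(rmorph_sign (@polyC K)) coefCM coefXn.
rewrite [LHS]/= big_nat_recr //= big_nat big1 => [|k /andP[_ ltkn]].
  rewrite add0r coefE eqxx mulr1 exprS mulN1r mulrN mulrAC -expr2 sqrr_sign.
  by rewrite mul1r.
by rewrite coefE gtn_eqF // !mulr0.
Qed.

(** Multiplication by 1 - X takes differences of consecutive coefficients, which
    undoes the partial summation that raises the order r by one. *)
Lemma hyperharmonic_fpsE r :
  hyperharmonic_fps r = - (fps_log (1 - fpsX) / (1 - fpsX) ^+ r).
Proof.
have unitX : 1 - fpsX \is a @GRing.unit (fps rat).
  by rewrite unit_fpsE fcoefD fcoefN /= coefX coef1 subr0.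
elim: r => [|r IHr].
  by apply: fpsP => n; rewrite divr1 fcoefN log_1subX opprK.
suff: hyperharmonic_fps r.+1 * (1 - fpsX) = hyperharmonic_fps r.
  move=> stepE; rewrite -[LHS](mulrK unitX) stepE IHr exprS invrM ?unitrX //.
  by rewrite mulNr mulrA.
apply: fpsP => n; rewrite mulrBr mulr1 fcoefD fcoefN fcoefMX.
case: n => [|[|n]] /=; rewrite ?subr0 ?big_nat1 //.
by rewrite [X in X - _]big_nat_recr //= addrAC subrr add0r.
Qed.

Theorem theorem12 (r : nat) :
  (Fps (det_hyperharmonic r)
     = 1 / (1 - fps_log (1 + fpsX) / (1 + fpsX) ^+ r) /\
   cf_value (det_num r) (det_den r)
     (1 / (1 - fps_log (1 + fpsX) / (1 + fpsX) ^+ r))) /\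
  (hyperharmonic_fps r = - (fps_log (1 - fpsX) / (1 - fpsX) ^+ r) /\
   cf_value (hyp_num r) (hyp_den r)
     (- (fps_log (1 - fpsX) / (1 - fpsX) ^+ r))).
Proof.
have unit1 (y : {poly rat}) : y.[0] = 0 -> ((1 + y) ^+ r).[0] != 0.
  by move=> y0; rewrite !hornerE y0 addr0 expr1n.
split; split.
- exact: fpsP.
- have -> : (1 + fpsX) ^+ r = fps_of_poly ((1 + 'X) ^+ r) :> fps rat.
    by rewrite rmorphXn rmorphD rmorph1.
  apply: inv_euler_cf_value => //; rewrite ?unit1 ?hornerX //.
  exact: Num.Theory.pchar_num.
- exact: hyperharmonic_fpsE.
have X0 : (- 'X : {poly rat}).[0] = 0 by rewrite hornerN hornerX oppr0.
have -> : hyp_num r = euler_num (- 'X) ((1 - 'X) ^+ r).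
  by apply: funext => -[|[|i]] /=; rewrite ?opprK ?mulNr ?mulrN.
have -> : hyp_den r = euler_den (- 'X) ((1 - 'X) ^+ r).
  by apply: funext => -[|i] //=; rewrite mulrN opprK.
have -> : 1 - fpsX = 1 + fps_of_poly (- 'X) :> fps rat by rewrite rmorphN.
have -> : (1 + fps_of_poly (- 'X)) ^+ r = fps_of_poly ((1 - 'X) ^+ r) :> fps rat.
  by rewrite rmorphXn rmorphD rmorph1.
by apply: euler_cf_value => //; [exact: Num.Theory.pchar_num | exact: unit1].
Qed.
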